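(* Let $\hat V=\hat V_{\mathrm c}+\hat V_{\mathrm e}:(0,\infty)\to\mathbb R$, where $\hat V_{\mathrm c},\hat V_{\mathrm e}$ are twice differentiable with $\hat V_{\mathrm c}''(r)\ge 0$ and $\hat V_{\mathrm e}''(r)\le 0$ for all $r>0$. Let $m>0$, $\Delta t_n>0$, and let $\bm q_n,\bm q_{n+1}\in\mathbb R^3\setminus\{\bm 0\}$, $\bm p_n,\bm p_{n+1}\in\mathbb R^3$ satisfy the generalized Eyre integrator $$\bm q_{n+1}-\bm q_n=\frac{\Delta t_n}{m}\,\bm p_{n+\frac12},\qquad \bm p_{n+1}-\bm p_n=-\Delta t_n\left(\hat V_{\mathrm c}'(\|\bm q_{n+1}\|)+\hat V_{\mathrm e}'(\|\bm q_n\|)\right)\frac{\bm q_{n+\frac12}}{\|\bm q\|_{n+\frac12}}.$$ Then $\bm J(\bm q_{n+1},\bm p_{n+1})=\bm J(\bm q_n,\bm p_n)$, and there exist $\xi_1,\xi_2\in(0,1)$ such that $$H(\bm q_{n+1},\bm p_{n+1})-H(\bm q_n,\bm p_n)=\frac{\left(\|\bm q_{n+1}\|-\|\bm q_n\|\right)^2}{2}\left(-\hat V_{\mathrm c}''(\|\bm q\|_{n+\xi_1})+\hat V_{\mathrm e}''(\|\bm q\|_{n+\xi_2})\right)\le 0.$$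
   Context: Single particle of mass $m$ in $\mathbb R^3$ in a central force field with potential $\hat V(\|\bm q\|)$; $\|\cdot\|$ is the Euclidean norm. Hamiltonian: $H(\bm q,\bm p)=\frac{1}{2m}\|\bm p\|^2+\hat V(\|\bm q\|)$. Angular momentum: $\bm J(\bm q,\bm p)=\bm q\times\bm p$. For $\alpha\in[0,1]$: $\bm q_{n+\alpha}:=(1-\alpha)\bm q_n+\alpha\bm q_{n+1}$, $\bm p_{n+\alpha}:=(1-\alpha)\bm p_n+\alpha\bm p_{n+1}$, and $\|\bm q\|_{n+\alpha}:=(1-\alpha)\|\bm q_n\|+\alpha\|\bm q_{n+1}\|$ (which in general differs from $\|\bm q_{n+\alpha}\|$). *)

(* Defs.v *)
From mathcomp Require Import all_boot all_order all_algebra.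
From mathcomp Require Import all_classical all_reals all_analysis.

Set Implicit Arguments.
Unset Strict Implicit.
Unset Printing Implicit Defensive.

Import Order.TTheory GRing.Theory Num.Theory.
Import numFieldNormedType.Exports.

Local Open Scope ring_scope.

(* The library norm `|u| on row vectors is the sup norm, hence this one. *)
Definition enorm (R : realType) (n : nat) (u : 'rV[R]_n) : R :=
  Num.sqrt (\sum_i u 0 i ^+ 2).

(* Indices are added in the cyclic ring 'I_3, i.e. modulo 3. *)
Definition cross (R : realType) (u v : 'rV[R]_3) : 'rV[R]_3 :=
  \row_(i < 3) (u 0 (i + 1) * v 0 (i + 2) - u 0 (i + 2) * v 0 (i + 1)).

(* [line_path] is the scalar analogue, used for the interpolated norm
   (1 - a) |q_n| + a |q_(n+1)|, which in general differs from
   enorm (lerp q_n q_(n+1) a). *)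
Definition lerp (R : realType) (n : nat) (x y : 'rV[R]_n) (a : R) : 'rV[R]_n :=
  (1 - a) *: x + a *: y.

Definition hamiltonian (R : realType) (m : R) (V : R -> R) (q p : 'rV[R]_3) : R :=
  (2 * m)^-1 * enorm p ^+ 2 + V (enorm q).

Definition angular_momentum (R : realType) (q p : 'rV[R]_3) : 'rV[R]_3 :=
  cross q p.

(* Potentials on (0, +oo) are total functions R -> R whose values at
   nonpositive arguments are irrelevant: (0, +oo) is open, so they do not
   affect the derivatives at positive points. *)
Definition twice_derivable_pos (R : realType) (f : R -> R) : Prop :=
  forall r : R, 0 < r -> derivable f r 1 /\ derivable (derive1 f) r 1.

(* One step (q0, p0) |-> (q1, p1), of time-step size dt. *)
Definition eyre_step (R : realType) (m dt : R) (Vc Ve : R -> R)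
    (q0 p0 q1 p1 : 'rV[R]_3) : Prop :=
  q1 - q0 = (dt / m) *: lerp p0 p1 2^-1 /\
  p1 - p0 = - (dt * (derive1 Vc (enorm q1) + derive1 Ve (enorm q0))) *:
    ((line_path (enorm q0) (enorm q1) 2^-1)^-1 *: lerp q0 q1 2^-1).

(* Main.v *)
(* The midpoint identity |y|^2 - |x|^2 = 2 (y - x) . (x + y)/2, applied to the
   momenta and then to the positions, telescopes the kinetic energy difference
   into -(Vc'(r1) + Ve'(r0)) (r1 - r0) with r0 = |q0| and r1 = |q1|: the
   denominator (r0 + r1)/2 of the scheme cancels the factor r0 + r1 of
   r1^2 - r0^2. The energy difference is then minus the Taylor remainder of Vc
   expanded at r1, plus that of Ve expanded at r0, both in Lagrange form. The
   same midpoint splitting of the cross product writes the change of angular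
   momentum as a sum of cross products of parallel vectors. *)
Require Import Defs.
From mathcomp Require Import all_boot all_order all_algebra.
From mathcomp Require Import ring lra.
From mathcomp Require Import all_classical all_reals all_analysis.

Set Implicit Arguments.
Unset Strict Implicit.
Unset Printing Implicit Defensive.

Import Order.TTheory GRing.Theory Num.Theory.
Import numFieldNormedType.Exports.

Local Open Scope ring_scope.

Definition dot (R : realType) (n : nat) (u v : 'rV[R]_n) : R :=
  \sum_i u 0 i * v 0 i.

Lemma dotC (R : realType) (n : nat) (u v : 'rV[R]_n) : dot u v = dot v u.
Proof. by apply: eq_bigr => i _; rewrite mulrC. Qed.

Lemma dotZl (R : realType) (n : nat) (a : R) (u v : 'rV[R]_n) :
  dot (a *: u) v = a * dot u v.
Proof. by rewrite /dot mulr_sumr; apply: eq_bigr => i _; rewrite mxE mulrA. Qed.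

Lemma dotZr (R : realType) (n : nat) (a : R) (u v : 'rV[R]_n) :
  dot u (a *: v) = a * dot u v.
Proof. by rewrite dotC dotZl dotC. Qed.

Lemma sqr_enorm (R : realType) (n : nat) (u : 'rV[R]_n) :
  enorm u ^+ 2 = dot u u.
Proof.
rewrite sqr_sqrtr; first by apply: eq_bigr => i _; rewrite expr2.
by apply: sumr_ge0 => i _; exact: sqr_ge0.
Qed.

Lemma sqr_enormB (R : realType) (n : nat) (x y : 'rV[R]_n) :
  enorm y ^+ 2 - enorm x ^+ 2 = 2 * dot (y - x) (lerp x y 2^-1).
Proof.
rewrite !sqr_enorm /dot -sumrB mulr_sumr; apply: eq_bigr => i _.
by rewrite !mxE; field.
Qed.

Lemma enorm_gt0 (R : realType) (n : nat) (u : 'rV[R]_n) :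
  u != 0 -> 0 < enorm u.
Proof.
have sq_ge0 (i : 'I_n) : true -> 0 <= u 0 i ^+ 2 by move=> _; exact: sqr_ge0.
move=> u_neq0; rewrite sqrtr_gt0 lt_neqAle sumr_ge0 // andbT eq_sym.
apply: contraNneq u_neq0 => sum0; apply/eqP/rowP => i; rewrite mxE.
move/eqP: sum0; rewrite psumr_eq0 // => /allP /(_ i (mem_index_enum i)).
by rewrite sqrf_eq0 => /eqP.
Qed.

(** By bilinearity: the mixed products of [x1] with [y0] and of [x0] with [y1] occur with opposite
    signs in the two terms and cancel. *)
Lemma crossB (R : realType) (x0 x1 y0 y1 : 'rV[R]_3) :
  cross x1 y1 - cross x0 y0 =
  cross (x1 - x0) (lerp y0 y1 2^-1) + cross (lerp x0 x1 2^-1) (y1 - y0).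
Proof. by apply/rowP => i; rewrite !mxE; field. Qed.

Lemma crossZl (R : realType) (a : R) (u v : 'rV[R]_3) :
  cross (a *: u) v = a *: cross u v.
Proof. by apply/rowP => i; rewrite !mxE; ring. Qed.

Lemma crossZr (R : realType) (a : R) (u v : 'rV[R]_3) :
  cross u (a *: v) = a *: cross u v.
Proof. by apply/rowP => i; rewrite !mxE; ring. Qed.

Lemma crossvv (R : realType) (u : 'rV[R]_3) : cross u u = 0.
Proof. by apply/rowP => i; rewrite !mxE; ring. Qed.

Lemma eyre_step_angular_momentum (R : realType) (m dt : R) (Vc Ve : R -> R)
    (q0 p0 q1 p1 : 'rV[R]_3) :
  eyre_step m dt Vc Ve q0 p0 q1 p1 ->
  angular_momentum q1 p1 = angular_momentum q0 p0.
Proof.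
move=> [dq dp]; apply/eqP; rewrite -subr_eq0 /angular_momentum crossB dq dp.
by rewrite crossZl !crossZr !crossvv !scaler0 addr0.
Qed.

Lemma eyre_step_kinetic (R : realType) (m dt : R) (Vc Ve : R -> R)
    (q0 p0 q1 p1 : 'rV[R]_3) :
  0 < m -> 0 < dt -> q0 != 0 -> q1 != 0 ->
  eyre_step m dt Vc Ve q0 p0 q1 p1 ->
  (2 * m)^-1 * enorm p1 ^+ 2 - (2 * m)^-1 * enorm p0 ^+ 2 =
  - (derive1 Vc (enorm q1) + derive1 Ve (enorm q0)) * (enorm q1 - enorm q0).
Proof.
move=> m_gt0 dt_gt0 /enorm_gt0 r0_gt0 /enorm_gt0 r1_gt0 [dq dp].
have dqP := sqr_enormB q0 q1; rewrite dq dotZl in dqP.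
rewrite -mulrBr sqr_enormB dp !dotZl.
(* The position update is solved for this product: it makes the midpoint momentum a multiple of
   [q1 - q0], which [dqP] pairs with the midpoint position. *)
have -> : dot (lerp q0 q1 2^-1) (lerp p0 p1 2^-1) =
    m / (2 * dt) * (enorm q1 ^+ 2 - enorm q0 ^+ 2).
  by rewrite dqP dotC; field; rewrite !gt_eqF.
by rewrite /line_path; field; rewrite !gt_eqF //; lra.
Qed.

Lemma unit_itvW (R : realType) (t : R) : 0 < t < 1 -> 0 <= t <= 1.
Proof. by case/andP => t_gt0 t_lt1; rewrite !ltW. Qed.

(** Keeps the interpolated radii inside the domain of the potentials, even if the segment from [q0]
    to [q1] meets the origin. *)
Lemma line_path_gt0 (R : realType) (a b t : R) :
  0 < a -> 0 < b -> 0 <= t <= 1 -> 0 < line_path a b t.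
Proof. by move=> a_gt0 b_gt0 /andP[t_ge0 t_le1]; rewrite /line_path; nra. Qed.

Lemma is_derive_line_path (R : realType) (a b t : R) :
  is_derive t 1 (line_path a b) (b - a).
Proof.
rewrite (_ : line_path a b = fun t => t * (b - a) + a); last first.
  by apply/funext => s; rewrite line_pathEl.
by apply: is_derive_eq; rewrite !scaler0 !add0r addr0 [_ *: _]mulr1.
Qed.

(** Rolle's theorem is applied in the parameter of the segment rather than in the radius, so that
    [a < b], [a = b] and [a > b] are treated at once and [t] is always strictly interior. *)
Lemma taylor2_pos (R : realType) (f : R -> R) (a b : R) :
  0 < a -> 0 < b -> twice_derivable_pos f ->
  exists2 t : R, 0 < t < 1 &
    f b - f a - derive1 f a * (b - a) =
    (b - a) ^+ 2 / 2 * derive1n 2 f (line_path a b t).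
Proof.
move=> a_gt0 b_gt0 f_diff.
pose x := line_path a b; set K := f b - f a - derive1 f a * (b - a).
(* Both endpoint values of [h] vanish, and [1 - t] factors out of [h']. *)
pose h (t : R) := f b - f (x t) - derive1 f (x t) * (b - x t) - K * (1 - t) ^+ 2.
have h' (t : R) : 0 <= t <= 1 -> is_derive t 1 h
    ((1 - t) * (2 * K - derive1n 2 f (x t) * (b - a) ^+ 2)).
  move=> /(line_path_gt0 a_gt0 b_gt0) xt_gt0.
  have [/derivableP fd /derivableP dfd] := f_diff _ xt_gt0.
  rewrite -!derive1E in fd dfd.
  have xd := is_derive_line_path a b t.
  have fxd := is_derive1_comp fd xd.
  have dfxd := is_derive1_comp dfd xd.
  have -> : h = cst (f b) - f \o x - (derive1 f \o x) * (cst b - x)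
      - K *: (cst 1 - id) ^+ 2.
    by apply/funext => s.
  apply: is_derive_eq.
  (* The derivative assembled by the product and chain rules, with scaling in [R] read as
     multiplication so that [ring] applies. *)
  change ((0 - derive1 f (x t)) * (b - a)
      - (derive1 f (x t) * (0 - (b - a))
         + (b - x t) * (derive1n 2 f (x t) * (b - a)))
      - K * (2 * (1 - t) * (0 - 1)) =
    (1 - t) * (2 * K - derive1n 2 f (x t) * (b - a) ^+ 2)).
  have -> : b - x t = (1 - t) * (b - a) by rewrite /x /line_path; ring.
  by ring.
have [t t_in ht] : exists2 t : R, t \in `]0, 1[ & is_derive t 1 h 0.
  apply: Rolle => //.
  - move=> t; rewrite in_itv /= => /unit_itvW t01.
    by apply: ex_derive; exact: h'.
  - apply: derivable_within_continuous => t; rewrite in_itv /= => t01.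
    by apply: ex_derive; exact: h'.
  - by rewrite /h /x line_path0 line_path1 /K; ring.
have t01 : 0 < t < 1 by move: t_in; rewrite in_itv.
exists t => //.
(* Both values of the derivative at [t] agree; since [t < 1], the factor [1 - t] can be cancelled,
   which leaves the equation for [K]. *)
have [_ e0] := ht; have [_] := h' t (unit_itvW t01); rewrite e0 => /esym/eqP.
rewrite mulf_eq0 subr_eq0 eq_sym lt_eqF; last by case/andP: t01.
by move=> /eqP eK; rewrite -/(x t); lra.
Qed.

Theorem proposition1 (R : realType) (V Vc Ve : R -> R) (m dt : R)
    (q0 q1 p0 p1 : 'rV[R]_3)
    (V_split : forall r : R, 0 < r -> V r = Vc r + Ve r)
    (Vc_diff : twice_derivable_pos Vc)
    (Ve_diff : twice_derivable_pos Ve)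
    (Vc_convex : forall r : R, 0 < r -> 0 <= derive1n 2 Vc r)
    (Ve_concave : forall r : R, 0 < r -> derive1n 2 Ve r <= 0)
    (m_gt0 : 0 < m) (dt_gt0 : 0 < dt)
    (q0_neq0 : q0 != 0) (q1_neq0 : q1 != 0)
    (step : eyre_step m dt Vc Ve q0 p0 q1 p1) :
  angular_momentum q1 p1 = angular_momentum q0 p0 /\
  exists xi1 xi2 : R,
    [/\ 0 < xi1 < 1,
        0 < xi2 < 1,
        hamiltonian m V q1 p1 - hamiltonian m V q0 p0 =
          (enorm q1 - enorm q0) ^+ 2 / 2 *
          (- derive1n 2 Vc (line_path (enorm q0) (enorm q1) xi1)
           + derive1n 2 Ve (line_path (enorm q0) (enorm q1) xi2))
      & (enorm q1 - enorm q0) ^+ 2 / 2 *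
          (- derive1n 2 Vc (line_path (enorm q0) (enorm q1) xi1)
           + derive1n 2 Ve (line_path (enorm q0) (enorm q1) xi2)) <= 0].
Proof.
have r0_gt0 := enorm_gt0 q0_neq0; have r1_gt0 := enorm_gt0 q1_neq0.
split; first exact: eyre_step_angular_momentum step.
(* Each expansion point is the radius at which the scheme evaluates that derivative, so the
   first-order terms cancel the kinetic energy difference. *)
have [s s01 Vc_taylor] := taylor2_pos r1_gt0 r0_gt0 Vc_diff.
have [t t01 Ve_taylor] := taylor2_pos r0_gt0 r1_gt0 Ve_diff.
(* The expansion of [Vc] runs from the new radius back to the old one; reversing the segment yields
   the witness [1 - s]. *)
rewrite line_path_sym in Vc_taylor.
have s01' : 0 < 1 - s < 1 by lra.
exists (1 - s), t; split=> //.
- have kin := eyre_step_kinetic m_gt0 dt_gt0 q0_neq0 q1_neq0 step.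
  rewrite /hamiltonian !V_split //; lra.
- have Vc''_ge0 := Vc_convex _ (line_path_gt0 r0_gt0 r1_gt0 (unit_itvW s01')).
  have Ve''_le0 := Ve_concave _ (line_path_gt0 r0_gt0 r1_gt0 (unit_itvW t01)).
  by apply: mulr_ge0_le0; [exact: divr_ge0 (sqr_ge0 _) _ | lra].
Qed.
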